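(* Let $\mathbf{\Pi}$ be the Hopf monoid of set partitions over $\mathbb{Q}$, with basis $\{\mathbf{x}_A\}$ as defined in the context. (1) Let $S=S_1\sqcup S_2$ be a finite set, $A\vdash S_1$, and $B\vdash S_2$. Then $$\mu_{S_1,S_2}(\mathbf{x}_A\otimes \mathbf{x}_B)=\mathbf{x}_{A\sqcup B}.$$ (2) Let $S=S_1\sqcup S_2$ be a finite set and $A\vdash S$. Then $$\Delta_{S_1,S_2}(\mathbf{x}_A)=\sum_{B\vdash S_1,\; C\vdash S_2} c_{B,C}\, \mathbf{x}_{B} \otimes \mathbf{x}_{C},$$ where $$c_{B,C}=\sum_{D} u(D,A),$$ the sum being over all set partitions $D\vdash S$ such that $D=D|_{S_1}\sqcup D|_{S_2}$, $D\leq A$, $B\leq D|_{S_1}$, and $C\leq D|_{S_2}$.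
   Context: A set partition $A$ of a finite set $S$, written $A\vdash S$, is a collection of disjoint nonempty subsets (blocks) of $S$ with union $S$; the empty set has a unique set partition $\emptyset$. A decomposition $S=S_1\sqcup S_2$ is an ordered pair of disjoint (possibly empty) subsets of $S$ with union $S$. For $A\vdash S$ and $T\subseteq S$, $A|_T\vdash T$ is the set partition whose blocks are the nonempty intersections of blocks of $A$ with $T$. For $S=S_1\sqcup S_2$, $A\vdash S_1$, $B\vdash S_2$, the disjoint union $A\sqcup B\vdash S$ is the set partition whose blocks are the blocks of $A$ together with the blocks of $B$. Set partitions of $S$ are ordered by refinement: $B\leq A$ if each block of $B$ is contained in some block of $A$. $u$ denotes the Möbius function of this lattice; for $B\le A$, $u(B,A)=\prod_{i}(-1)^{\lambda_i-1}(\lambda_i-1)!$, where $\lambda_i$ is the number of blocks of $B$ contained in the $i$th block of $A$. For a finite set $S$, $\mathbf{\Pi}[S]$ is the $\mathbb{Q}$-vector space with basis $\{\mathbf{m}_A : A\vdash S\}$. For $S=S_1\sqcup S_2$, the product $\mu_{S_1,S_2}:\mathbf{\Pi}[S_1]\otimes\mathbf{\Pi}[S_2]\to\mathbf{\Pi}[S]$ and coproduct $\Delta_{S_1,S_2}:\mathbf{\Pi}[S]\to\mathbf{\Pi}[S_1]\otimes\mathbf{\Pi}[S_2]$ are the linear maps given by $$\mu_{S_1,S_2}(\mathbf{m}_A\otimes\mathbf{m}_B)=\sum_{C\vdash S:\ C|_{S_1}=A,\ C|_{S_2}=B}\mathbf{m}_C,$$ $$\Delta_{S_1,S_2}(\mathbf{m}_A)=\begin{cases}\mathbf{m}_{A|_{S_1}}\otimes\mathbf{m}_{A|_{S_2}}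 & \text{if } A=A|_{S_1}\sqcup A|_{S_2},\\ 0&\text{otherwise.}\end{cases}$$ Two further bases of $\mathbf{\Pi}[S]$ are $$\mathbf{p}_A=\sum_{B\geq A}\mathbf{m}_B,\qquad \mathbf{x}_A=\sum_{B\leq A}u(B,A)\,\mathbf{p}_B .$$ *)

(* Defs.v *)
From HB Require Import structures.
From mathcomp Require Import all_boot all_order all_algebra.

Set Implicit Arguments.
Unset Strict Implicit.
Unset Printing Implicit Defensive.

Import Order.TTheory GRing.Theory Num.Theory.
Local Open Scope ring_scope.

(* n is fuel; mobiusxx, mobius_lt and mobius_nle below are the defining        *)
(* equations of the Moebius function.                                          *)

Fixpoint mobius_rec (d : Order.disp_t) (P : finPOrderType d) (n : nat)
    (x y : P) : int :=
  if n is n'.+1 then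
    if x == y then 1
    else if (x < y)%O then
      - \sum_(z : P | (x <= z < y)%O) mobius_rec n' x z
    else 0
  else 0.

Definition mobius (d : Order.disp_t) (P : finPOrderType d) (x y : P) : int :=
  mobius_rec #|P| x y.

Lemma mobius_rec_fuel (d : Order.disp_t) (P : finPOrderType d) (x : P) n m y :
  (#|[set z : P | (x <= z < y)%O]| < n)%N ->
  (#|[set z : P | (x <= z < y)%O]| < m)%N ->
  mobius_rec n x y = mobius_rec m x y.
Proof.
elim: n m y => // n IHn [|m] y //= ltn ltm.
case: eqP => // _; case: ifP => // _; congr (- _).
apply: eq_bigr => z /andP[lexz ltzy].
have lt_card : (#|[set t : P | (x <= t < z)%O]| <
                #|[set t : P | (x <= t < y)%O]|)%N.
  apply: proper_card; apply/properP; split.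
    apply/subsetP => t; rewrite !inE => /andP[-> ltz].
    exact: lt_trans ltz ltzy.
  by exists z; rewrite !inE ?lexz ?ltzy ?ltxx ?andbF.
by apply: IHn; apply: leq_trans lt_card _.
Qed.

Lemma card_itv_lt (d : Order.disp_t) (P : finPOrderType d) (x y : P) :
  (#|[set z : P | (x <= z < y)%O]| < #|P|)%N.
Proof.
rewrite -cardsT; apply: proper_card; rewrite properT.
by apply/eqP => /setP/(_ y); rewrite !inE ltxx andbF.
Qed.

Lemma mobiusxx (d : Order.disp_t) (P : finPOrderType d) (x : P) :
  mobius x x = 1.
Proof.
rewrite /mobius; case E: #|P| => [|n] /=; last by rewrite eqxx.
by move: (fintype0 x E).
Qed.

Lemma mobius_lt (d : Order.disp_t) (P : finPOrderType d) (x y : P) :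
  (x < y)%O -> mobius x y = - \sum_(z : P | (x <= z < y)%O) mobius x z.
Proof.
move=> ltxy.
rewrite {1}/mobius (@mobius_rec_fuel _ _ x _ #|P|.+1) ?card_itv_lt //=; last first.
  by rewrite ltnS ltnW // card_itv_lt.
by rewrite (lt_eqF ltxy) ltxy.
Qed.

Lemma mobius_nle (d : Order.disp_t) (P : finPOrderType d) (x y : P) :
  ~~ (x <= y)%O -> mobius x y = 0.
Proof.
move=> nle; rewrite /mobius; case: #|P| => //= n.
have /negPf-> : x != y by apply: contraNneq nle => ->.
by have /negPf-> : ~~ (x < y)%O by apply: contraNN nle => /ltW.
Qed.

Record setpart (T : finType) (S : {set T}) := SetPart {
  blocks :> {set {set T}};
  blocksP : partition blocks S
}.

HB.instance Definition _ (T : finType) (S : {set T}) :=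
  [isSub for @blocks T S].
HB.instance Definition _ (T : finType) (S : {set T}) :=
  [Finite of setpart S by <:].

Definition refines (T : finType) (S : {set T}) (B A : setpart S) : bool :=
  [forall (b | b \in blocks B), [exists (a | a \in blocks A), b \subset a]].

Lemma refinesP (T : finType) (S : {set T}) (B A : setpart S) :
  reflect (forall b, b \in blocks B ->
             exists2 a, a \in blocks A & b \subset a) (refines B A).
Proof.
apply: (iffP forall_inP) => H b bB.
  by have /exists_inP[a aA ba] := H b bB; exists a.
by have [a aA ba] := H b bB; apply/exists_inP; exists a.
Qed.

Lemma refines_refl (T : finType) (S : {set T}) :
  reflexive (@refines T S).
Proof. by move=> A; apply/refinesP => a aA; exists a. Qed.

Lemma refines_trans (T : finType) (S : {set T}) :
  transitive (@refines T S).
Proof.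
move=> B A C /refinesP AB /refinesP BC; apply/refinesP => a /AB[b /BC[c cC bc] ab].
by exists c => //; apply: subset_trans ab bc.
Qed.

Lemma refines_anti (T : finType) (S : {set T}) :
  antisymmetric (@refines T S).
Proof.
have sub (A B : setpart S) : refines A B -> refines B A -> blocks A \subset blocks B.
  move=> /refinesP AB /refinesP BA; apply/subsetP => a aA.
  have [b bB ab] := AB a aA; have [a' a'A ba'] := BA b bB.
  have tA := partition_trivIset (blocksP A).
  have [x xa] := set0Pn _ (partition_neq0 (blocksP A) aA).
  have xa' : x \in a' by apply: (subsetP ba'); apply: (subsetP ab).
  have eqa : a = a' by rewrite -(def_pblock tA aA xa) -(def_pblock tA a'A xa').
  suff -> : a = b by [].
  by apply/eqP; rewrite eqEsubset ab eqa.
move=> A B /andP[AB BA]; apply/val_inj/eqP.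
by rewrite eqEsubset; apply/andP; split; apply: sub.
Qed.

Fact refinement_display : Order.disp_t. Proof. exact: Order.Disp tt tt. Qed.

HB.instance Definition _ (T : finType) (S : {set T}) :=
  Order.Le_isPOrder.Build refinement_display (setpart S)
    (@refines_refl T S) (@refines_anti T S) (@refines_trans T S).

(* S1 and S2 may be empty.                                                     *)
Definition decomposition (T : finType) (S S1 S2 : {set T}) : bool :=
  [disjoint S1 & S2] && (S == S1 :|: S2).

Lemma decomposition_subl (T : finType) (S S1 S2 : {set T}) :
  decomposition S S1 S2 -> S1 \subset S.
Proof. by case/andP => _ /eqP->; apply: subsetUl. Qed.

Lemma decomposition_subr (T : finType) (S S1 S2 : {set T}) :
  decomposition S S1 S2 -> S2 \subset S.
Proof. by case/andP => _ /eqP->; apply: subsetUr. Qed.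

Definition restrict_blocks (T : finType) (U : {set T}) (A : {set {set T}}) :
    {set {set T}} :=
  [set a :&: U | a in A & a :&: U != set0].

Lemma restrict_blocksP (T : finType) (S U : {set T}) (A : setpart S) :
  U \subset S -> partition (restrict_blocks U (blocks A)) U.
Proof.
move=> sUS; have tA := partition_trivIset (blocksP A).
apply/and3P; split.
- rewrite eqEsubset; apply/andP; split.
    by apply/bigcupsP => b /imsetP[a _ ->]; apply: subsetIr.
  apply/subsetP => x xU.
  have: x \in cover (blocks A).
    by rewrite (cover_partition (blocksP A)) (subsetP sUS).
  case/bigcupP => a aA xa; apply/bigcupP; exists (a :&: U); last by rewrite inE xa.
  apply/imsetP; exists a => //; rewrite inE aA.
  by apply/set0Pn; exists x; rewrite inE xa.
- apply/trivIsetP => _ _ /imsetP[a + ->] /imsetP[b + ->].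
  rewrite !inE => /andP[aA _] /andP[bA _] neq.
  have neab : a != b by apply: contraNneq neq => ->.
  apply: disjointWl (subsetIl _ _) _; apply: disjointWr (subsetIl _ _) _.
  exact: (trivIsetP tA).
by apply/imsetP => -[a]; rewrite inE => /andP[_ /eqP ne0] /esym.
Qed.

Definition restrict (T : finType) (S U : {set T}) (sUS : U \subset S)
    (A : setpart S) : setpart U :=
  SetPart (restrict_blocksP A sUS).

Lemma disjU_partition (T : finType) (S S1 S2 : {set T})
    (dS : decomposition S S1 S2) (A : setpart S1) (B : setpart S2) :
  partition (blocks A :|: blocks B) S.
Proof.
case/andP: dS => dis /eqP->.
have [/and3P[/eqP cA tA nA] /and3P[/eqP cB tB nB]] := (blocksP A, blocksP B).
apply/and3P; split.
- by rewrite /cover bigcup_setU -!/(cover _) cA cB.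
- by apply: trivIsetU => //; rewrite cA cB.
by rewrite inE negb_or nA.
Qed.

Definition disjU (T : finType) (S S1 S2 : {set T})
    (dS : decomposition S S1 S2) (A : setpart S1) (B : setpart S2) : setpart S :=
  SetPart (disjU_partition dS A B).

Definition splits (T : finType) (S S1 S2 : {set T})
    (dS : decomposition S S1 S2) (A : setpart S) : bool :=
  A == disjU dS (restrict (decomposition_subl dS) A)
                (restrict (decomposition_subr dS) A).

(* The rational vector space with basis I, as coordinate vectors; rat^o is rat *)
(* seen as a module over itself.                                               *)

Notation freeQ I := {ffun I -> rat^o}.

Definition basis (I : finType) (i : I) : freeQ I := [ffun j => (j == i)%:R].

Definition linext (I : finType) (V : lmodType rat) (f : I -> V) (v : freeQ I) : V :=
  \sum_i v i *: f i.

Fact linext_is_linear (I : finType) (V : lmodType rat) (f : I -> V) :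
  linear (linext f).
Proof.
move=> a u v; rewrite /linext scaler_sumr -big_split; apply: eq_bigr => i _ /=.
by rewrite !ffunE scalerDl scalerA.
Qed.

HB.instance Definition _ (I : finType) (V : lmodType rat) (f : I -> V) :=
  GRing.isLinear.Build rat (freeQ I) V _ (linext f) (linext_is_linear f).

Lemma linext_basis (I : finType) (V : lmodType rat) (f : I -> V) (i : I) :
  linext f (basis i) = f i.
Proof.
rewrite /linext (bigD1 i) //= ffunE eqxx scale1r big1 ?addr0 // => j ji.
by rewrite ffunE (negPf ji) scale0r.
Qed.

Lemma free_basis (I : finType) (v : freeQ I) : v = \sum_i v i *: basis i.
Proof.
apply/ffunP => j; rewrite sum_ffunE (bigD1 j) //= !ffunE eqxx big1 ?addr0 //.
  by rewrite /GRing.scale /= mulr1.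
by move=> i ij; rewrite !ffunE eq_sym (negPf ij) scaler0.
Qed.

(* freeQ I (x) freeQ J is realized as freeQ (I * J), the pure tensor u (x) v     *)
(* having coordinates u_i v_j.                                                *)
Definition tensor (I J : finType) (u : freeQ I) (v : freeQ J) : freeQ (I * J)%type :=
  [ffun ij => u ij.1 * v ij.2].

Lemma tensor_basis (I J : finType) (i : I) (j : J) :
  tensor (basis i) (basis j) = basis (i, j).
Proof.
by apply/ffunP => -[k l]; rewrite !ffunE /= -natrM mulnb xpair_eqE.
Qed.

Lemma tensor_linearl (I J : finType) (v : freeQ J) :
  linear (fun u : freeQ I => tensor u v).
Proof. by move=> a u u'; apply/ffunP => ij; rewrite !ffunE mulrDl -mulrA. Qed.

Lemma tensor_linearr (I J : finType) (u : freeQ I) :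
  linear (fun v : freeQ J => tensor u v).
Proof.
by move=> a v v'; apply/ffunP => ij; rewrite !ffunE mulrDr; congr (_ + _);
   rewrite /GRing.scale /= mulrCA.
Qed.

Notation Pi S := (freeQ (setpart S)).
Notation Pi2 S1 S2 := (freeQ (setpart S1 * setpart S2)%type).

Definition m_ (T : finType) (S : {set T}) (A : setpart S) : Pi S := basis A.

Definition p_ (T : finType) (S : {set T}) (A : setpart S) : Pi S :=
  \sum_(B : setpart S | (A <= B)%O) m_ B.

Definition x_ (T : finType) (S : {set T}) (A : setpart S) : Pi S :=
  \sum_(B : setpart S | (B <= A)%O) (mobius B A)%:Q *: p_ B.

Definition mu (T : finType) (S S1 S2 : {set T}) (dS : decomposition S S1 S2) :
    Pi2 S1 S2 -> Pi S :=
  linext (fun AB : setpart S1 * setpart S2 =>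
    \sum_(C : setpart S | (restrict (decomposition_subl dS) C == AB.1) &&
                          (restrict (decomposition_subr dS) C == AB.2)) m_ C).

HB.instance Definition _ (T : finType) (S S1 S2 : {set T})
    (dS : decomposition S S1 S2) :=
  GRing.isLinear.Build rat (Pi2 S1 S2) (Pi S) _ (mu dS) (linext_is_linear _).

Definition Delta (T : finType) (S S1 S2 : {set T})
    (dS : decomposition S S1 S2) : Pi S -> Pi2 S1 S2 :=
  linext (fun A : setpart S =>
    if splits dS A then
      tensor (m_ (restrict (decomposition_subl dS) A))
             (m_ (restrict (decomposition_subr dS) A))
    else 0).

HB.instance Definition _ (T : finType) (S S1 S2 : {set T})
    (dS : decomposition S S1 S2) :=
  GRing.isLinear.Build rat (Pi S) (Pi2 S1 S2) _ (Delta dS) (linext_is_linear _).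

(* Main.v *)
Require Import Defs.
From HB Require Import structures.
From mathcomp Require Import all_boot all_order all_algebra.

Import Order.TTheory GRing.Theory Num.Theory.
Local Open Scope ring_scope.

(* Moebius inversion gives [p_A = \sum_(B <= A) x_B].  On the p basis the product
   is [p_A p_B = p_(A ⊔ B)], and the partitions below [A ⊔ B] are exactly the
   [A' ⊔ B'] with [A' <= A], [B' <= B]; hence [x_A x_B] and [x_(A ⊔ B)] have the
   same sums over all lower intervals, so they agree.  This avoids computing the
   Moebius function of a product.  Dually, Delta sends [p_A] to
   [p_(A|S1) (x) p_(A|S2)] if [A] splits and to 0 otherwise; expanding both sides
   in the x basis gives the second formula. *)

(** For [x < y] the defining recursion makes the term at [z = y] the negative of the sum of all the
    others. *)
Lemma sum_mobius (d : Order.disp_t) (P : finPOrderType d) (x y : P) :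
  \sum_(z : P | (x <= z <= y)%O) mobius x z = (x == y)%:R.
Proof.
have [<-|neqxy] := eqVneq x y.
  rewrite (big_pred1 x) ?mobiusxx // => z /=.
  by rewrite -eq_le eq_sym.
case lexy: (x <= y)%O; last first.
  rewrite big_pred0 // => z; apply: contraFF lexy => /andP[]; exact: le_trans.
have ltxy : (x < y)%O by rewrite lt_neqAle neqxy.
rewrite (bigD1 y) /=; last by rewrite lexy lexx.
rewrite mobius_lt // addrC; apply/eqP; rewrite subr_eq0; apply/eqP.
by apply: eq_bigl => z; rewrite lt_neqAle -andbA [(z <= y)%O && _]andbC.
Qed.

(** Uniqueness half of Moebius inversion: by induction on the number of elements strictly below [y],
    all terms but the top one agree and cancel. *)
Lemma eq_lower_sums (d : Order.disp_t) (P : finPOrderType d) (V : zmodType)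
    (f g : P -> V) :
  (forall y, \sum_(z | (z <= y)%O) f z = \sum_(z | (z <= y)%O) g z) -> f =1 g.
Proof.
move=> eqfg y; have [n] := ubnP #|[set z : P | (z < y)%O]|.
elim: n y => // n IHn y; rewrite ltnS => leyn.
have := eqfg y; rewrite (bigD1 y) //= [RHS](bigD1 y) //=.
rewrite [X in _ + X = _](eq_bigr g) => [/addIr //|z /andP[lezy nezy]].
have ltzy : (z < y)%O by rewrite lt_neqAle nezy.
apply: IHn; apply: leq_trans leyn; apply: proper_card; apply/properP; split.
  by apply/subsetP => t; rewrite !inE => /lt_trans; apply.
by exists z; rewrite !inE ?ltxx.
Qed.

Lemma tensor_sum (I J : finType) (K L : Type) (r : seq K) (s : seq L)
    (P : pred K) (Q : pred L) (f : K -> freeQ I) (g : L -> freeQ J) :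
  tensor (\sum_(k <- r | P k) f k) (\sum_(l <- s | Q l) g l) =
  \sum_(k <- r | P k) \sum_(l <- s | Q l) tensor (f k) (g l).
Proof.
apply/ffunP => ij; rewrite !ffunE !sum_ffunE big_distrlr /=.
by apply: eq_bigr => k _; rewrite sum_ffunE; apply: eq_bigr => l _; rewrite ffunE.
Qed.

(** After exchanging the sums, the coefficient of [p_ C] is the sum of [mobius C B] over
    [C <= B <= A], which vanishes unless [C = A]. *)
Lemma p_sum_x (T : finType) (S : {set T}) (A : setpart S) :
  p_ A = \sum_(B | (B <= A)%O) x_ B.
Proof.
rewrite /x_ (exchange_big_dep (fun C => (C <= A)%O)) /=; last first.
  by move=> B C BA CB; apply: le_trans CB BA.
rewrite (bigD1 A) //= (big_pred1 A) => [|B]; last by rewrite -eq_le.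
rewrite mobiusxx scale1r big1 ?addr0 // => C /andP[CA neCA].
rewrite -scaler_suml -rmorph_sum /=.
rewrite (eq_bigl (fun B => (C <= B <= A)%O)) => [|B]; last by rewrite andbC.
by rewrite sum_mobius (negPf neCA) scale0r.
Qed.

Lemma mem_restrict (T : finType) (S U : {set T}) (sUS : U \subset S)
    (A : setpart S) (b : {set T}) :
  reflect (exists a, [/\ a \in blocks A, a :&: U != set0 & b = a :&: U])
          (b \in blocks (restrict sUS A)).
Proof.
apply: (iffP imsetP) => [[a]|[a [aA aU ->]]].
  by rewrite inE => /andP[aA aU] ->; exists a.
by exists a; rewrite // inE aA.
Qed.

Lemma block_neq0 (T : finType) (S : {set T}) (A : setpart S) a :
  a \in blocks A -> a != set0.
Proof. exact: (partition_neq0 (blocksP A)). Qed.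

Lemma block_sub (T : finType) (S : {set T}) (A : setpart S) a :
  a \in blocks A -> a \subset S.
Proof. by move=> aA; rewrite -(cover_partition (blocksP A)) (bigcup_sup a). Qed.

Lemma le_setpartP (T : finType) (S : {set T}) (B A : setpart S) :
  reflect (forall b, b \in blocks B ->
             exists2 a, a \in blocks A & b \subset a) (B <= A)%O.
Proof. exact: refinesP. Qed.

Section Decomposition.

Variables (T : finType) (S S1 S2 : {set T}) (dS : decomposition S S1 S2).

Local Notation resl := (restrict (decomposition_subl dS)).
Local Notation resr := (restrict (decomposition_subr dS)).

Let disS : S1 :&: S2 = set0.
Proof. by case/andP: dS => /disjoint_setI0. Qed.

(** Disjoint union is left adjoint to the pair of restrictions: a nonempty subset of [U] lies in a
    block [c] exactly when it lies in [c :&: U], which is then a block of the restriction. *)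
Lemma le_disjU_restrict (A : setpart S1) (B : setpart S2) (C : setpart S) :
  (disjU dS A B <= C)%O = (A <= resl C)%O && (B <= resr C)%O.
Proof.
have le_resE (U : {set T}) (sUS : U \subset S) (D : setpart U) :
    (forall a, a \in blocks D -> exists2 c, c \in blocks C & a \subset c) <->
    (D <= restrict sUS C)%O.
  split=> [DC|/le_setpartP DC a aD].
    apply/le_setpartP => a aD; have [c cC ac] := DC a aD.
    have acU : a \subset c :&: U by rewrite subsetI ac (block_sub _ _ D).
    exists (c :&: U) => //; apply/mem_restrict; exists c; split=> //.
    apply: contraNneq (block_neq0 _ _ D a aD) => cU.
    by rewrite -subset0 -cU.
  have [_ /mem_restrict[c [cC _ ->]]] := DC a aD.
  by rewrite subsetI => /andP[ac _]; exists c.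
apply/le_setpartP/andP => [H|[/le_resE HA /le_resE HB] a].
  by split; apply/le_resE => a aX; apply: H; rewrite inE aX ?orbT.
by rewrite inE => /orP[/HA|/HB].
Qed.

Lemma restrict_disjU (A : setpart S1) (B : setpart S2) :
  (resl (disjU dS A B) = A) * (resr (disjU dS A B) = B).
Proof.
(* The adjunction at [C = disjU dS A B] gives one inequality on each side. For the converse, blocks
   coming from the opposite side meet the set in [set0] and so contribute nothing. *)
have /andP[leA leB] : (A <= resl (disjU dS A B))%O && (B <= resr (disjU dS A B))%O.
  by rewrite -le_disjU_restrict.
have meet0 (a U V : {set T}) : a \subset U -> U :&: V = set0 -> a :&: V = set0.
  by move=> aU UV; apply/eqP; rewrite -subset0 -UV setSI.
split; apply/le_anti; rewrite ?leA ?leB andbT; apply/le_setpartP.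
  move=> _ /mem_restrict[a [+ + ->]]; rewrite inE => /orP[aA _|aB].
    by exists a => //; apply: subsetIl.
  by rewrite (meet0 _ _ _ (block_sub _ _ B a aB)) ?eqxx // setIC.
move=> _ /mem_restrict[a [+ + ->]]; rewrite inE => /orP[aA|aB _].
  by rewrite (meet0 _ _ _ (block_sub _ _ A a aA)) ?eqxx.
by exists a => //; apply: subsetIl.
Qed.

Lemma le_disjU (A A' : setpart S1) (B B' : setpart S2) :
  (disjU dS A B <= disjU dS A' B')%O = (A <= A')%O && (B <= B')%O.
Proof. by rewrite le_disjU_restrict !restrict_disjU. Qed.

Lemma splits_disjU (A : setpart S1) (B : setpart S2) : splits dS (disjU dS A B).
Proof. by rewrite /splits !restrict_disjU. Qed.

Lemma splits_blocksP (A : setpart S) :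
  reflect (forall a, a \in blocks A -> (a \subset S1) || (a \subset S2))
          (splits dS A).
Proof.
apply: (iffP eqP) => [-> a|H].
  by rewrite inE => /orP[] /block_sub ->; rewrite ?orbT.
(* The adjunction gives one inequality for free; for the other, a block inside [S1] or [S2] is
   unchanged by intersecting with that set. *)
apply/le_anti; rewrite le_disjU_restrict !lexx !andbT.
apply/le_setpartP => a aA; exists a => //; have a0 := block_neq0 _ _ A a aA.
rewrite inE; apply/orP; case/orP: (H a aA) => /setIidPl aE; [left|right];
  by apply/mem_restrict; exists a; rewrite aE.
Qed.

Lemma splits_le (A B : setpart S) : (B <= A)%O -> splits dS A -> splits dS B.
Proof.
move=> /le_setpartP BA /splits_blocksP sA; apply/splits_blocksP => b /BA[a aA ba].
by case/orP: (sA a aA) => /(subset_trans ba) ->; rewrite ?orbT.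
Qed.

(** On split partitions, [disjU] is inverted by the pair of restrictions, so the sum can be
    reindexed by pairs. *)
Lemma sum_splits (V : nmodType) (P : pred (setpart S)) (F : setpart S -> V) :
  (forall D, P D -> splits dS D) ->
  \sum_(D | P D) F D =
  \sum_(AB : setpart S1 * setpart S2 | P (disjU dS AB.1 AB.2))
     F (disjU dS AB.1 AB.2).
Proof.
move=> sP; rewrite (reindex_onto (fun AB => disjU dS AB.1 AB.2)
                                 (fun D => (resl D, resr D))) /=.
  by apply: eq_bigl => -[A B] /=; rewrite !restrict_disjU eqxx andbT.
by move=> D /sP /eqP.
Qed.

Lemma mu_p (A : setpart S1) (B : setpart S2) :
  mu dS (tensor (p_ A) (p_ B)) = p_ (disjU dS A B).
Proof.
rewrite /p_ tensor_sum pair_big /= linear_sum /=.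
(* Group the partitions above [disjU dS A B] by their two restrictions: each group is the support of
   one product of [m_] basis elements. *)
rewrite [RHS](partition_big (fun C => (resl C, resr C))
  (fun CD : setpart S1 * setpart S2 => (A <= CD.1)%O && (B <= CD.2)%O)) /=.
  apply: eq_bigr => -[C D] /= leCD; rewrite /m_ tensor_basis /mu linext_basis /=.
  apply: eq_bigl => E; rewrite xpair_eqE le_disjU_restrict.
  by case: eqP => [->|]; case: eqP => [->|]; rewrite ?leCD ?andbF.
by move=> C; rewrite le_disjU_restrict.
Qed.

Lemma mu_x (A : setpart S1) (B : setpart S2) :
  mu dS (tensor (x_ A) (x_ B)) = x_ (disjU dS A B).
Proof.
(* Invert twice, in [A] with [B] fixed and then in [B]. *)
move: A; apply: eq_lower_sums => A; move: B; apply: eq_lower_sums => B.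
rewrite exchange_big [RHS]exchange_big /= [RHS]pair_big /=.
under [RHS]eq_bigl do rewrite -le_disjU.
(* Everything below a split partition splits, so the sum over pairs is a full lower sum of [x_ D],
   namely [p_ (disjU dS A B)]. *)
rewrite -(@sum_splits _ (fun D => (D <= disjU dS A B)%O) (fun D => x_ D)); last first.
  by move=> D /splits_le; apply; apply: splits_disjU.
rewrite -p_sum_x -mu_p !p_sum_x tensor_sum linear_sum /=.
by apply: eq_bigr => A' _; rewrite linear_sum.
Qed.

Lemma Delta_p (A : setpart S) :
  Delta dS (p_ A) =
  if splits dS A then tensor (p_ (resl A)) (p_ (resr A)) else 0.
Proof.
rewrite {1}/p_ linear_sum /=.
under eq_bigr do rewrite /m_ /Delta linext_basis.
(* Only split [B >= A] survive; there are none unless [A] itself splits, since splitting passes to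
   refinements. *)
rewrite -big_mkcondr /=; case: ifP => [|nsA]; last first.
  rewrite big_pred0 // => B; apply: contraFF nsA => /andP[]; exact: splits_le.
move=> /eqP defA; rewrite sum_splits => [|D /andP[]//].
rewrite /p_ tensor_sum pair_big /=.
apply: eq_big => [[B C]|[B C] _] /=; last by rewrite !restrict_disjU.
by rewrite splits_disjU andbT {1}defA le_disjU.
Qed.

Lemma Delta_x (A : setpart S) :
  Delta dS (x_ A) =
  \sum_(B : setpart S1) \sum_(C : setpart S2)
    (\sum_(D : setpart S | [&& splits dS D, (D <= A)%O, (B <= resl D)%O
        & (C <= resr D)%O]) mobius D A)%:Q *: tensor (x_ B) (x_ C).
Proof.
rewrite {1}/x_ linear_sum /= pair_bigA /=.
under [RHS]eq_bigr => BC _ do rewrite rmorph_sum scaler_suml /=.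
(* With [D] outermost, the inner sum over pairs for a fixed split [D <= A] is the expansion of
   [tensor (p_ (resl D)) (p_ (resr D))] in the x basis. *)
rewrite [RHS](exchange_big_dep (fun D => (D <= A)%O && splits dS D)) /=; last first.
  by move=> BC D _ /and4P[-> ->].
rewrite [RHS]big_mkcondr /=; apply: eq_bigr => D DA.
rewrite linearZ /= Delta_p; case: ifP => sD; last by rewrite scaler0.
rewrite !p_sum_x tensor_sum pair_big /= scaler_sumr.
by apply: eq_bigl => BC; rewrite DA.
Qed.

End Decomposition.

Theorem theorem3p1 (T : finType) (S S1 S2 : {set T})
    (dS : decomposition S S1 S2) :
  (forall (A : setpart S1) (B : setpart S2),
     mu dS (tensor (x_ A) (x_ B)) = x_ (disjU dS A B)) /\
  (forall A : setpart S,
     Delta dS (x_ A) =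
     \sum_(B : setpart S1) \sum_(C : setpart S2)
       (\sum_(D : setpart S | [&& splits dS D, (D <= A)%O,
            (B <= restrict (decomposition_subl dS) D)%O
          & (C <= restrict (decomposition_subr dS) D)%O]) mobius D A)%:Q
       *: tensor (x_ B) (x_ C)).
Proof. by split; [apply: mu_x | apply: Delta_x]. Qed.
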